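(* Let $I \subseteq \mathbb{R}$ be an interval, let $f,g \in MT(I)$, let $a,b \in I$ with $a<b$, and suppose $fg \in L_1[a,b]$. Then $$\frac{1}{b-a}\int_a^b \mu(x) f(x) g(x)\,dx \leq \frac{1}{12}\left[f(a)g(a)+f(b)g(b)\right] + \frac{1}{24}\left[f(a)g(b)+f(b)g(a)\right],$$ where $\mu(x) = \frac{(b-x)(x-a)}{(b-a)^2}$ for $x \in [a,b]$.
   Context: A function $f: I \subseteq \mathbb{R} \to \mathbb{R}$ is said to belong to the class $MT(I)$ (to be $MT$-convex on $I$) if it is nonnegative and for all $x,y \in I$ and all $t \in (0,1)$ it satisfies $$f(tx+(1-t)y) \leq \frac{\sqrt{t}}{2\sqrt{1-t}} f(x) + \frac{\sqrt{1-t}}{2\sqrt{t}} f(y).$$ $L_1[a,b]$ denotes the Lebesgue integrable functions on $[a,b]$. *)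

(* Defs.v *)
From HB Require Import structures.
From mathcomp Require Import all_boot all_order all_algebra.
From mathcomp Require Import all_classical all_reals all_analysis.

Set Implicit Arguments.
Unset Strict Implicit.
Unset Printing Implicit Defensive.

Import Order.TTheory GRing.Theory Num.Theory.
Import numFieldNormedType.Exports.

Local Open Scope classical_set_scope.
Local Open Scope ring_scope.

(* A function I -> R is represented by a total function of which only the
   values on I are constrained. *)
Definition MT_convex (R : realType) (I : set R) (f : R -> R) : Prop :=
  (forall x, I x -> 0 <= f x) /\
  (forall x y t, I x -> I y -> 0 < t -> t < 1 ->
    f (t * x + (1 - t) * y) <=
      Num.sqrt t / (2 * Num.sqrt (1 - t)) * f x
      + Num.sqrt (1 - t) / (2 * Num.sqrt t) * f y).

Definition mt_weight (R : realType) (a b x : R) : R :=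
  (b - x) * (x - a) / (b - a) ^+ 2.

(* [lebesgue_measure] lives on the Borel sigma-algebra, so integrability with
   respect to it would demand Borel measurability; the completed measure lives
   on the sigma-algebra of all Lebesgue measurable sets. *)
Definition L1_on (R : realType) (a b : R) (h : R -> R) : Prop :=
  (@completed_lebesgue_measure R).-integrable `[a, b] (fun x => (h x)%:E).

Definition Lebesgue_integral (R : realType) (a b : R) (h : R -> R) : R :=
  Rintegral (@completed_lebesgue_measure R) `[a, b] h.

(* Main.v *)
Require Import Defs.
From HB Require Import structures.
From mathcomp Require Import all_boot all_order all_algebra.
From mathcomp Require Import all_classical all_reals all_analysis.
From mathcomp Require Import measurable_realfun ring lra.

(** Multiplying the MT-inequality at t by sqrt (t (1 - t)) clears the singular
    coefficients: sqrt (t (1 - t)) f (t x + (1 - t) y) is at most half the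
    chord t f x + (1 - t) f y.  Multiplying the bounds for f and g with
    t = (b - x) / (b - a) bounds mu f g on [a, b] by a quadratic polynomial
    whose integral, divided by b - a, is exactly the right-hand side. *)

Import Order.TTheory GRing.Theory Num.Theory.
Import numFieldNormedType.Exports.

Local Open Scope classical_set_scope.
Local Open Scope ring_scope.

Local Notation completed_line R :=
  (caratheodory_type (@wlength R idfun)^*%mu).

(** Borel sets are Caratheodory measurable; composing with this identity carries Borel functions
    over to the completed line. *)
Lemma measurable_id_completed (R : realType) :
  measurable_fun setT (fun x : completed_line R => (x : measurableTypeR R)).
Proof. by move=> _ A mA; rewrite setTI; exact: sub_caratheodory. Qed.

(* Lebesgue measure is the pushforward of its completion under the identity. *)
Lemma ge0_integral_completed (R : realType) (D : set R) (h : R -> R) :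
  measurable (D : set (measurableTypeR R)) ->
  measurable_fun (D : set (measurableTypeR R)) h ->
  (forall x, D x -> 0 <= h x) ->
  (\int[@completed_lebesgue_measure R]_(x in D) (h x)%:E =
   \int[@lebesgue_measure R]_(x in D) (h x)%:E)%E.
Proof.
move=> mD mh h0.
have := @ge0_integral_pushforward _ _ _ _ _ _ (measurable_id_completed R)
  (@completed_lebesgue_measure R) D (EFin \o h) mD.
move=> <- //.
- exact/measurable_EFinP.
- by move=> x /set_mem Dx; rewrite lee_fin h0.
Qed.

(** Fundamental theorem of calculus; in powers of [x - a] the antiderivative [F] vanishes at [a]. *)
Lemma integral_quadratic (R : realType) (a b c0 c1 c2 : R) : a < b ->
  (\int[@lebesgue_measure R]_(x in `[a, b])
     (c0 + c1 * (x - a) + c2 * (x - a) ^+ 2)%:E =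
   (c0 * (b - a) + c1 / 2 * (b - a) ^+ 2 + c2 / 3 * (b - a) ^+ 3)%:E)%E.
Proof.
move=> ab.
pose F (x : R) : R :=
  c0 * (x - a) + c1 / 2 * (x - a) ^+ 2 + c2 / 3 * (x - a) ^+ 3.
have dF (x : R) : is_derive x 1 F (c0 + c1 * (x - a) + c2 * (x - a) ^+ 2).
  rewrite /F; apply: is_derive_eq.
  by rewrite /GRing.scale /=; field.
have cF : continuous F.
  by move=> x; apply: differentiable_continuous; apply/derivable1_diffP.
rewrite (@continuous_FTC2 _ _ F)//.
- rewrite -EFinB /F subrr !expr0n /= !mulr0 !addr0 subr0//.
- apply: continuous_subspaceT => x.
  apply: cvgD.
    by apply: cvgD; [exact: cvg_cst|apply: cvgM; [exact: cvg_cst|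
      apply: cvgB; [exact: cvg_id|exact: cvg_cst]]].
  apply: cvgM; first exact: cvg_cst.
  by apply: cvgM; apply: cvgB; [exact: cvg_id|exact: cvg_cst|
     exact: cvg_id|exact: cvg_cst].
- split=> [x _||]; first exact: ex_derive.
    exact/cvg_at_right_filter/cF.
  exact/cvg_at_left_filter/cF.
- by move=> x _; rewrite derive1E derive_val.
Qed.

Lemma MT_convex_chord (R : realType) (I : set R) (f : R -> R) (x y t : R) :
  MT_convex I f -> I x -> I y -> 0 < t -> t < 1 ->
  Num.sqrt t * Num.sqrt (1 - t) * f (t * x + (1 - t) * y)
  <= (t * f x + (1 - t) * f y) / 2.
Proof.
move=> [f0 fc] Ix Iy t0 t1; have t1' : 0 < 1 - t by rewrite subr_gt0.
have s0 : 0 < Num.sqrt t by rewrite sqrtr_gt0.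
have r0 : 0 < Num.sqrt (1 - t) by rewrite sqrtr_gt0.
apply: le_trans (ler_wpM2l (ltW (mulr_gt0 s0 r0)) (fc x y t Ix Iy t0 t1)) _.
have ss := sqr_sqrtr (ltW t0); have rr := sqr_sqrtr (ltW t1').
(* With the roots abstracted to [s] and [r], where [s ^+ 2 = t] and [r ^+ 2 = 1 - t], both sides
   agree as rational expressions. *)
move: (Num.sqrt t) (Num.sqrt (1 - t)) s0 r0 ss rr => s r s0 r0 ss rr.
rewrite -rr -ss le_eqVlt; apply/orP; left; apply/eqP; field.
by rewrite !gt_eqF.
Qed.

Lemma MT_convex_chordM (R : realType) (I : set R) (f g : R -> R) (x y t : R) :
  is_interval I -> MT_convex I f -> MT_convex I g -> I x -> I y -> x <= y ->
  0 <= t -> t <= 1 ->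
  t * (1 - t) * (f (t * x + (1 - t) * y) * g (t * x + (1 - t) * y))
  <= (t * f x + (1 - t) * f y) * (t * g x + (1 - t) * g y) / 4.
Proof.
move=> hI hf hg Ix Iy xy t0 t1.
have [f0 _] := hf; have [g0 _] := hg.
have fx := f0 x Ix; have fy := f0 y Iy.
have gx := g0 x Ix; have gy := g0 y Iy.
(* At [t = 0] and [t = 1] the MT-inequality says nothing, but the left side is zero and the right
   side nonnegative. *)
have [/eqP ->|] := boolP (t * (1 - t) == 0).
  by rewrite mul0r divr_ge0// mulr_ge0// addr_ge0// mulr_ge0// subr_ge0.
rewrite mulf_eq0 negb_or subr_eq0 => /andP[t_neq0 t_neq1].
have tgt0 : 0 < t by rewrite lt_def t_neq0.
have tlt1 : t < 1 by rewrite lt_def t_neq1.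
have cf := MT_convex_chord _ _ _ _ _ _ hf Ix Iy tgt0 tlt1.
have cg := MT_convex_chord _ _ _ _ _ _ hg Ix Iy tgt0 tlt1.
set z := t * x + (1 - t) * y in cf cg *.
have Iz : I z by apply: (hI x y Ix Iy); rewrite /z; apply/andP; split; nra.
set p := Num.sqrt t * Num.sqrt (1 - t) in cf cg.
have p0 : 0 <= p by rewrite mulr_ge0// sqrtr_ge0.
have pp : t * (1 - t) = p * p.
  by rewrite -expr2 exprMn !sqr_sqrtr// subr_ge0.
(* One factor [p] goes to each function; the two chord bounds multiply because their left sides are
   nonnegative. *)
rewrite pp mulrACA.
apply: le_trans (ler_pM _ _ cf cg) _; last by rewrite mulf_div -natrM.
- by rewrite mulr_ge0// f0.
- by rewrite mulr_ge0// g0.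
Qed.

Theorem theorem4 (R : realType) (I : set R) (f g : R -> R) (a b : R)
  (hI : is_interval I) (hf : MT_convex I f) (hg : MT_convex I g)
  (ha : I a) (hb : I b) (hab : a < b)
  (hfg : L1_on a b (fun x => f x * g x)) :
  1 / (b - a) * Lebesgue_integral a b (fun x => mt_weight a b x * f x * g x)
  <= 1 / 12 * (f a * g a + f b * g b) + 1 / 24 * (f a * g b + f b * g a).
Proof.
have L0 : 0 < b - a by rewrite subr_gt0.
have Lneq0 : b - a != 0 by rewrite gt_eqF.
(* [q] is a quarter of the product of the chords of [f] and [g], expanded in powers of [x - a]. *)
pose c0 := f a * g a / 4.
pose c1 := (f a * (g b - g a) + g a * (f b - f a)) / (4 * (b - a)).
pose c2 := (f b - f a) * (g b - g a) / (4 * (b - a) ^+ 2).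
pose q x := c0 + c1 * (x - a) + c2 * (x - a) ^+ 2.
pose h x := mt_weight a b x * f x * g x.
have h0 x : `[a, b]%classic x -> 0 <= h x.
  rewrite /= in_itv /= => xab; have Ix := hI a b ha hb x xab.
  move/andP: xab => [ax xb].
  rewrite mulr_ge0 ?hg.1// mulr_ge0 ?hf.1// /mt_weight.
  by rewrite divr_ge0 ?exprn_ge0 ?mulr_ge0 ?subr_ge0// ltW.
have hq x : `[a, b]%classic x -> h x <= q x.
  rewrite /= in_itv /= => /andP[ax xb].
  have t0 : 0 <= (b - x) / (b - a) by rewrite divr_ge0 ?subr_ge0// ltW.
  have t1 : (b - x) / (b - a) <= 1 by rewrite ler_pdivrMr// mul1r lerD2l lerN2.
  have := MT_convex_chordM _ _ _ _ _ _ _ hI hf hg ha hb (ltW hab) t0 t1.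
  have -> : (b - x) / (b - a) * a + (1 - (b - x) / (b - a)) * b = x by field.
  (* Here [1 - t = (x - a) / (b - a)], so [t * (1 - t)] is the weight. *)
  congr (_ <= _); first by rewrite /h /mt_weight; field.
  by rewrite /q /c0 /c1 /c2; field.
have mq : measurable_fun setT (q : measurableTypeR R -> R).
  by do ?apply: measurable_funD => //; apply: measurable_funM => //;
    try apply: measurable_funX; apply: measurable_funB.
(* Measurability of [f * g] comes from [hfg]; the weight is Borel. *)
have mh : measurable_fun (`[a, b] : set (completed_line R)) h.
  have /measurable_EFinP mfg := measurable_int _ hfg.
  rewrite (_ : h = (mt_weight a b \* (fun x => f x * g x))); last first.
    by apply/funext => x; rewrite /h /= mulrA.
  apply: measurable_funM => //.
  have mw : measurable_fun setT (mt_weight a b : measurableTypeR R -> R).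
    apply: measurable_funM => //; apply: measurable_funM => //;
      exact: measurable_funB.
  apply: measurable_funTS.
  exact: (measurableT_comp mw (measurable_id_completed R)).
have hqi : (\int[@completed_lebesgue_measure R]_(x in `[a, b]) (h x)%:E <=
    (c0 * (b - a) + c1 / 2 * (b - a) ^+ 2 + c2 / 3 * (b - a) ^+ 3)%:E)%E.
  rewrite -integral_quadratic// -ge0_integral_completed//; last 2 first.
    exact: measurable_funTS.
    by move=> x xab; apply: le_trans (h0 x xab) (hq x xab).
  apply: ge0_le_integral.
  - exact: sub_caratheodory.
  - by move=> x xab; rewrite lee_fin h0.
  - exact/measurable_EFinP.
  - apply/measurable_EFinP/measurable_funTS.
    exact: (measurableT_comp mq (measurable_id_completed R)).
  - by move=> x xab; rewrite lee_fin hq.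
have int_le : Lebesgue_integral a b h <=
    c0 * (b - a) + c1 / 2 * (b - a) ^+ 2 + c2 / 3 * (b - a) ^+ 3.
  (* [fine] sends an infinite integral to 0, so finiteness is checked first; it follows from
     [hqi]. *)
  rewrite -lee_fin /Lebesgue_integral /Rintegral fineK//.
  rewrite ge0_fin_numE; first exact: le_lt_trans hqi (ltry _).
  by apply: integral_ge0 => x xab; rewrite lee_fin h0.
rewrite mul1r ler_pdivrMl//; apply: le_trans int_le _.
(* Equality holds: [f a * g a] collects 1/4 - 1/4 + 1/12, [f b * g b] gets 1/12, and each mixed
   product 1/8 - 1/12 = 1/24. *)
rewrite le_eqVlt; apply/orP; left; apply/eqP.
by rewrite /c0 /c1 /c2; field.
Qed.
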